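(* Let $H$ be a real Hilbert space, let $K\subseteq H$ be a closed convex cone, and define $p:H\to[0,\infty)$ by $p(x)=\lVert P_Kx\rVert$. Then: (i) $p$ is sublinear; (ii) if the polar cone $K^\circ$ is a pointed closed convex cone, then $p$ is an asymmetric seminorm.
   Context: $H$ is a real Hilbert space with inner product $\langle\cdot,\cdot\rangle$ and norm $\lVert x\rVert=\sqrt{\langle x,x\rangle}$. A closed convex cone is a nonempty closed set $K\subseteq H$ such that $\lambda x+\mu y\in K$ for all $x,y\in K$ and all real $\lambda,\mu\ge 0$. It is pointed if $K\cap(-K)=\{0\}$. The dual cone is $K^*=\{x\in H:\langle x,y\rangle\ge 0\text{ for every }y\in K\}$ and the polar cone is $K^\circ=-K^*$. $P_Kx$ denotes the metric projection of $x$ onto $K$, i.e. the unique point of $K$ with $\lVert x-P_Kx\rVert=\min_{y\in K}\lVert x-y\rVert$. A function $q:H\to\mathbb{R}$ is sublinear if $q(\lambda x)=\lambda q(x)$ and $q(x+y)\le q(x)+q(y)$ for all real $\lambda\ge 0$ and all $x,y\in H$. An asymmetric seminorm is a sublinear function $q:H\to[0,\infty)$ such that $q(x)=q(-x)=0$ implies $x=0$. *)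

(* Defs.v *)
From mathcomp Require Export all_boot all_order all_algebra.
From mathcomp Require Export all_classical all_reals all_analysis.
Export Order.TTheory GRing.Theory Num.Theory.
Export numFieldNormedType.Exports.

#[export] Set Implicit Arguments.
#[export] Unset Strict Implicit.
#[export] Unset Printing Implicit Defensive.

Local Open Scope classical_set_scope.
Local Open Scope ring_scope.

Definition closed_convex_cone (R : realType) (H : normedModType R)
    (K : set H) : Prop :=
  [/\ K !=set0, closed K &
      forall (x y : H) (a b : R), K x -> K y -> 0 <= a -> 0 <= b ->
        K (a *: x + b *: y)].

Definition opp_set (V : zmodType) (A : set V) : set V := -%R @` A.

Definition pointed_cone (R : realType) (H : normedModType R)
    (K : set H) : Prop := K `&` opp_set K = [set 0].

(* A {dot H for idfun} is a symmetric, bilinear, positive definite form on H *)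
Definition dual_cone (R : realType) (H : normedModType R)
    (inner : {dot H for idfun}) (K : set H) : set H :=
  [set x | forall y, K y -> 0 <= inner x y].

Definition polar_cone (R : realType) (H : normedModType R)
    (inner : {dot H for idfun}) (K : set H) : set H :=
  opp_set (dual_cone inner K).

Definition is_metric_proj (R : realType) (H : normedModType R)
    (K : set H) (x y : H) : Prop :=
  K y /\ forall z, K z -> `|x - y| <= `|x - z|.

(* xget chooses an element of the set, and returns its first argument (here 0)
   only if the set is empty; the set of nearest points is a singleton when K
   is nonempty, closed and convex in a Hilbert space. *)
Definition metric_proj (R : realType) (H : normedModType R)
    (K : set H) (x : H) : H := xget 0 [set y | is_metric_proj K x y].

Definition sublinear (R : realType) (H : lmodType R) (q : H -> R) : Prop :=
  (forall (a : R) (x : H), 0 <= a -> q (a *: x) = a * q x) /\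
  (forall x y : H, q (x + y) <= q x + q y).

Definition asymmetric_seminorm (R : realType) (H : lmodType R)
    (q : H -> R) : Prop :=
  [/\ sublinear q,
      forall x, 0 <= q x &
      forall x, q x = 0 -> q (- x) = 0 -> x = 0].

(* Main.v *)
Require Import Defs.
From mathcomp Require Import ring lra.

(** The proof rests on one description of the projection [y = P_K x] onto a
    closed convex cone: [<x, z> <= <y, z>] for every [z] in [K], with equality
    for [z = y].  Hence [<x, z> <= |P_K x| |z|] on [K], and this bound is
    attained at [z = P_K x], where it reads [<x, P_K x> = |P_K x| ^ 2].  In
    other words [x |-> |P_K x|] is the support function of the part of [K] in
    the unit ball, and a support function is sublinear; the argument below
    reads off both sublinearity properties from these two facts, without
    forming the supremum.

    For the second part, [P_K x = 0] makes [<x, z> <= 0] for every [z] in [K],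
    so that [x] lies in the polar cone.  If this also holds for [- x], then [x]
    lies in the polar cone and in its opposite, and pointedness gives [x = 0].

    The projection is given as a chosen nearest point, so that a nearest point
    must first be shown to exist.  By the parallelogram law, the points of
    [K] that almost realize the distance to [x] are close to one another; they
    form a Cauchy filter, which converges because the space is complete
    (lemma [nearest_point_exists]).  The description of the projection comes
    from moving the nearest point inside the cone and looking at the first-order
    variation of the distance (lemmas [inner_le0_of_nearest] and
    [metric_proj_coneP]). *)

Local Open Scope classical_set_scope.
Local Open Scope ring_scope.

(** * The norm of an inner product space *)

Lemma innerC (R : realType) (H : lmodType R) (inner : {dot H for idfun})
    (x y : H) : inner x y = inner y x.
Proof. by rewrite hermC expr0 mul1r. Qed.

Lemma sqr_norm_inner (R : realType) (H : normedModType R)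
    (inner : {dot H for idfun})
    (norm_inner : forall x : H, `|x| = Num.sqrt (inner x x)) (x : H) :
  `|x| ^+ 2 = inner x x.
Proof.
rewrite norm_inner sqr_sqrtr //.
have [->|x0] := eqVneq x 0; first by rewrite linear0l.
exact/ltW/neq0_dnorm_gt0.
Qed.

Lemma sqr_norm_subZ (R : realType) (H : normedModType R)
    (inner : {dot H for idfun})
    (norm_inner : forall x : H, `|x| = Num.sqrt (inner x x))
    (u z : H) (t : R) :
  `|u - t *: z| ^+ 2 = `|u| ^+ 2 - 2 * t * inner u z + t ^+ 2 * `|z| ^+ 2.
Proof.
rewrite !(sqr_norm_inner norm_inner) !linearBl !linearBr !linearZl_LR.
(* bilinearity rewrites leave scalings of R by itself, which are products *)
rewrite !linearZr_LR /= /GRing.scale /= (innerC inner z u); ring.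
Qed.

Lemma parallelogram_midpoint (R : realType) (H : normedModType R)
    (inner : {dot H for idfun})
    (norm_inner : forall x : H, `|x| = Num.sqrt (inner x x)) (x z w : H) :
  `|z - w| ^+ 2 =
    2 * `|x - z| ^+ 2 + 2 * `|x - w| ^+ 2
    - 4 * `|x - 2^-1 *: (z + w)| ^+ 2.
Proof.
rewrite !(sqr_norm_inner norm_inner) !linearBl !linearBr !linearZl_LR.
rewrite !linearZr_LR /= !linearDl !linearDr /GRing.scale /=.
rewrite (innerC inner z x) (innerC inner w x) (innerC inner w z); lra.
Qed.

(** Since the norm comes with its triangle inequality, Cauchy-Schwarz follows
    by expanding the square of [|x + y| <= |x| + |y|]. *)
Lemma inner_le_norm (R : realType) (H : normedModType R)
    (inner : {dot H for idfun})
    (norm_inner : forall x : H, `|x| = Num.sqrt (inner x x)) (x y : H) :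
  inner x y <= `|x| * `|y|.
Proof.
have: `|x + y| ^+ 2 <= (`|x| + `|y|) ^+ 2.
  by rewrite ler_sqr ?nnegrE ?addr_ge0// ler_normD.
rewrite sqrrD !(sqr_norm_inner norm_inner) !linearDl !linearDr.
by rewrite /= (innerC inner y x); lra.
Qed.

(** * Nearest points *)

(** If [z] and [w] almost realize the distance from [K] to [x], their midpoint
    does no better than the infimum, being in [K]; the parallelogram law then
    bounds [|z - w|], so that the sets of near-minimizers shrink and generate
    a Cauchy filter.  Its limit is the nearest point. *)
Lemma nearest_point_exists (R : realType) (H : completeNormedModType R)
    (inner : {dot H for idfun})
    (norm_inner : forall x : H, `|x| = Num.sqrt (inner x x))
    (K : set H) (K0 : K !=set0) (Kcl : closed K)
    (Kmid : forall z w, K z -> K w -> K (2^-1 *: (z + w))) (x : H) :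
  exists y, is_metric_proj K x y.
Proof.
set D := [set `|x - z| ^+ 2 | z in K].
have D_inf : has_inf D.
  split; first by case: K0 => z Kz; exists (`|x - z| ^+ 2), z.
  by exists 0 => _ [z _ <-]; rewrite sqr_ge0.
set d := inf D.
have d_le z : K z -> d <= `|x - z| ^+ 2.
  by move=> Kz; apply: ge_inf; [case: D_inf|exists z].
pose S e := [set z | K z /\ `|x - z| ^+ 2 <= d + e].
pose F := filter_from [set e : R | 0 < e] S.
have FF : ProperFilter F.
  apply: filter_from_proper.
    apply: filter_from_filter; first by exists 1 => /=.
    move=> e f /= e0 f0; exists (Num.min e f); first by rewrite /= lt_min e0.
    move=> z [Kz zd]; split; split => //; apply: (le_trans zd);
      by rewrite lerD2l ge_min lexx ?orbT.
  move=> e /= e0; have [_ [z Kz <-] zd] := inf_adherent e0 D_inf.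
  by exists z; split => //; exact: ltW.
have S_small e z w : S e z -> S e w -> `|z - w| ^+ 2 <= 4 * e.
  move=> [Kz zd] [Kw wd]; rewrite (parallelogram_midpoint norm_inner x).
  by have := d_le _ (Kmid _ _ Kz Kw); lra.
have Fcauchy : cauchy F.
  apply: cauchy_exP => e e0.
  (* two points of S ((e / 4) ^+ 2) are at distance at most e / 2 < e *)
  have e40 : 0 < (e / 4) ^+ 2 by rewrite exprn_gt0// divr_gt0.
  have [_ [z Kz <-] zd] := inf_adherent e40 D_inf.
  have Sz : S ((e / 4) ^+ 2) z by split => //; exact: ltW.
  exists z, ((e / 4) ^+ 2) => // w Sw; rewrite -ball_normE /=.
  apply: (@le_lt_trans _ _ (e / 2)); last by lra.
  rewrite -ler_sqr ?nnegrE//; last by lra.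
  by apply: (le_trans (S_small _ _ _ Sz Sw)); nra.
have /cvg_ex[y Fy] : cvg F by exact/cauchy_cvgP.
have Ky : K y.
  apply: (closed_cvg (F := F) (u_ := id) K Kcl) Fy.
  by exists 1 => //= z [].
have y_le e : 0 < e -> `|x - y| ^+ 2 <= d + e.
  move=> e0.
  have Fn : `|x - z| ^+ 2 @[z --> F] --> `|x - y| ^+ 2.
    rewrite expr2; under eq_fun do rewrite expr2.
    by apply: cvgM; apply: cvg_norm; apply: cvgB => //; exact: cvg_cst.
  apply: (closed_cvg [set r | r <= d + e] (@closed_le _ (d + e)) _ _ Fn).
  by exists e => //= z [].
exists y; split => // z Kz.
rewrite -ler_sqr ?nnegrE//; apply: le_trans (d_le _ Kz).
by apply/ler_addgt0Pr => e; exact: y_le.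
Qed.

(** To first order in [t], [|u - t z| ^ 2] is [|u| ^ 2 - 2 t <u, z>], which
    would decrease if [<u, z>] were positive. *)
Lemma inner_le0_of_nearest (R : realType) (H : normedModType R)
    (inner : {dot H for idfun})
    (norm_inner : forall x : H, `|x| = Num.sqrt (inner x x)) (u z : H) :
  (forall t : R, 0 < t -> t <= 1 -> `|u| <= `|u - t *: z|) -> inner u z <= 0.
Proof.
move=> umin; rewrite leNgt; apply/negP => a0.
set a := inner u z in a0; set N := `|z| ^+ 2.
have N0 : 0 <= N by rewrite sqr_ge0.
have aN0 : 0 < a + N by lra.
(* this t makes t * N <= a, so that t ^+ 2 * N does not offset 2 * t * a *)
pose t := a / (a + N).
have t0 : 0 < t by rewrite divr_gt0.
have taN : t * (a + N) = a by rewrite divfK// gt_eqF.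
have t1 : t <= 1 by rewrite ler_pdivrMr// mul1r; lra.
have := umin _ t0 t1; rewrite -ler_sqr ?nnegrE//.
rewrite (sqr_norm_subZ norm_inner) -/a -/N => h.
have ta0 := mulr_gt0 t0 a0; have tta0 := mulr_gt0 t0 ta0.
have : t * (t * (a + N)) = t * a by rewrite taN.
by lra.
Qed.

(** * Projection onto a closed convex cone *)

(** Moving the nearest point [y] to [y + t z] gives the inequality; moving it
    to [(1 - t) y], which stays in the cone for [t <= 1], gives the reverse
    inequality at [z = y].  Together they are the Moreau decomposition: [x - y]
    lies in the polar cone and is orthogonal to [y]. *)
Lemma metric_proj_coneP (R : realType) (H : completeNormedModType R)
    (inner : {dot H for idfun})
    (norm_inner : forall x : H, `|x| = Num.sqrt (inner x x))
    (K : set H) (hK : closed_convex_cone K) (x : H) :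
  let y := metric_proj K x in
  [/\ K y, (forall z, K z -> inner x z <= inner y z) & inner x y = `|y| ^+ 2].
Proof.
move=> y; have [K0 Kcl Kcone] := hK.
have Kmid z w : K z -> K w -> K (2^-1 *: (z + w)).
  by move=> Kz Kw; rewrite scalerDr; apply: Kcone.
have [Ky ymin] : is_metric_proj K x y.
  have [y' y'P] := nearest_point_exists norm_inner K0 Kcl Kmid x.
  exact: (xgetPex 0 (ex_intro _ y' y'P)).
have polar z : K z -> inner (x - y) z <= 0.
  move=> Kz; apply: (inner_le0_of_nearest norm_inner) => t t0 _.
  rewrite -addrA -opprD; apply: ymin.
  by rewrite -[y]scale1r; apply: Kcone => //; exact: ltW.
have inner_xy z : K z -> inner x z <= inner y z.
  by move=> /polar; rewrite linearBl subr_le0.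
split => //; apply/eqP; rewrite (sqr_norm_inner norm_inner) eq_le inner_xy//=.
have : inner (x - y) (- y) <= 0.
  apply: (inner_le0_of_nearest norm_inner) => t t0 t1.
  rewrite scalerN opprK -addrA.
  have -> : - y + t *: y = - ((1 - t) *: y + 0 *: y).
    by rewrite scale0r addr0 scalerBl scale1r opprB addrC.
  by apply: ymin; apply: Kcone => //; rewrite subr_ge0.
by rewrite linearNr linearBl oppr_le0 subr_ge0.
Qed.

Lemma inner_le_norm_metric_proj (R : realType) (H : completeNormedModType R)
    (inner : {dot H for idfun})
    (norm_inner : forall x : H, `|x| = Num.sqrt (inner x x))
    (K : set H) (hK : closed_convex_cone K) (x z : H) :
  K z -> inner x z <= `|metric_proj K x| * `|z|.
Proof.
move=> Kz; have [_ xy _] := metric_proj_coneP norm_inner hK x.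
exact: le_trans (xy _ Kz) (inner_le_norm norm_inner _ _).
Qed.

(** The equality [<x, P_K x> = |P_K x| ^ 2] turns any bound on [<x, .>] over
    [K] by [c] times the norm into the bound [c] on [|P_K x|]. *)
Lemma norm_metric_proj_le (R : realType) (H : completeNormedModType R)
    (inner : {dot H for idfun})
    (norm_inner : forall x : H, `|x| = Num.sqrt (inner x x))
    (K : set H) (hK : closed_convex_cone K) (x : H) (c : R) :
  0 <= c -> (forall z, K z -> inner x z <= c * `|z|) -> `|metric_proj K x| <= c.
Proof.
move=> c0 xc; have [Ky _ xy] := metric_proj_coneP norm_inner hK x.
have := xc _ Ky; rewrite xy expr2.
have [->|y0] := eqVneq (metric_proj K x) 0; first by rewrite normr0.
by rewrite ler_pM2r// normr_gt0.
Qed.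

Lemma sublinear_norm_metric_proj (R : realType) (H : completeNormedModType R)
    (inner : {dot H for idfun})
    (norm_inner : forall x : H, `|x| = Num.sqrt (inner x x))
    (K : set H) (hK : closed_convex_cone K) :
  sublinear (fun x : H => `|metric_proj K x|).
Proof.
have inner_le := inner_le_norm_metric_proj norm_inner hK.
split=> [a x a0|x y].
  have norm_le : `|metric_proj K (a *: x)| <= a * `|metric_proj K x|.
    apply: (norm_metric_proj_le norm_inner hK) => [|z Kz].
      by rewrite mulr_ge0.
    by rewrite linearZl_LR /= -mulrA ler_wpM2l// inner_le.
  apply/eqP; rewrite eq_le norm_le /=.
  have [->|a_neq0] := eqVneq a 0; first by rewrite mul0r.
  have {}a0 : 0 < a by rewrite lt_neqAle eq_sym a_neq0.
  rewrite mulrC -ler_pdivlMr//.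
  apply: (norm_metric_proj_le norm_inner hK) => [|z Kz].
    by rewrite divr_ge0// ltW.
  rewrite mulrAC ler_pdivlMr// mulrC.
  by have := inner_le (a *: x) z Kz; rewrite linearZl_LR.
apply: (norm_metric_proj_le norm_inner hK) => [|z Kz].
  by rewrite addr_ge0.
by rewrite linearDl mulrDl lerD// inner_le.
Qed.

Lemma polar_cone_metric_proj0 (R : realType) (H : completeNormedModType R)
    (inner : {dot H for idfun})
    (norm_inner : forall x : H, `|x| = Num.sqrt (inner x x))
    (K : set H) (hK : closed_convex_cone K) (x : H) :
  metric_proj K x = 0 -> polar_cone inner K x.
Proof.
move=> px0; exists (- x); last by rewrite opprK.
move=> z Kz; rewrite linearNl oppr_ge0.
by have [_ /(_ _ Kz)] := metric_proj_coneP norm_inner hK x; rewrite px0 linear0l.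
Qed.

Theorem theorem3p4 (R : realType) (H : completeNormedModType R)
    (inner : {dot H for idfun})
    (norm_inner : forall x : H, `|x| = Num.sqrt (inner x x))
    (K : set H) (hK : closed_convex_cone K) :
  let p := fun x : H => `|metric_proj K x| in
  sublinear p /\
  (closed_convex_cone (polar_cone inner K) /\
     pointed_cone (polar_cone inner K) ->
   asymmetric_seminorm p).
Proof.
move=> p; have p_sub := sublinear_norm_metric_proj norm_inner hK.
split=> // -[_ polar_pointed]; split=> //; first by move=> x; rewrite normr_ge0.
move=> x px pNx.
have polar0 := polar_cone_metric_proj0 norm_inner hK.
suff : (polar_cone inner K `&` opp_set (polar_cone inner K)) x.
  by rewrite polar_pointed.
split; first exact/polar0/normr0_eq0.
by exists (- x); [exact/polar0/normr0_eq0|rewrite opprK].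
Qed.
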